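(* Let $\mathcal Q,\mathcal T,\mathcal W$ be Hilbert spaces, $\mathcal R\subseteq\mathcal Q$ and $\mathcal U\subseteq\mathcal T$, and let $(P,u)\in\mathcal M\times\mathcal U$. Let $\gamma:\mathcal M\times\mathcal U\to\mathcal R$ and $\eta:\mathcal M\times\mathcal R\to\mathcal W$ be totally pathwise differentiable at $(P,u)$ and $(P,\gamma(P,u))$, respectively. Then $\beta:\mathcal M\times\mathcal U\to\mathcal W$, defined by $\beta(P',u')=\eta(P',\gamma(P',u'))$, is totally pathwise differentiable at $(P,u)$ with $$\dot\beta_{P,u}(s,t)=\dot\eta_{P,\gamma(P,u)}\big(s,\dot\gamma_{P,u}(s,t)\big)$$ and, for $w\in\mathcal W$, $$\dot\beta_{P,u}^*(w)=\big(\dot\eta_{P,\gamma(P,u)}^*(w)_0,\,0\big)+\dot\gamma_{P,u}^*\big(\dot\eta_{P,\gamma(P,u)}^*(w)_1\big),$$ where $\dot\eta_{P,\gamma(P,u)}^*(w)_0\in\dot{\mathcal M}_P$ and $\dot\eta_{P,\gamma(P,u)}^*(w)_1\in\dot{\mathcal R}_{\gamma(P,u)}$ are defined by $\dot\eta_{P,\gamma(P,u)}^*(w)=\big(\dot\eta_{P,\gamma(P,u)}^*(w)_0,\dot\eta_{P,\gamma(P,u)}^*(w)_1\big)$.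
   Context: All Hilbert spaces are real. $\mathcal M$ is a set of probability distributions on a measurable space $\mathcal Z$. For $P\in\mathcal M$ and $s\in L^2(P)$, $\mathscr P(P,\mathcal M,s)$ is the collection of submodels $\{P_\epsilon:\epsilon\in[0,1]\}\subseteq\mathcal M$ with $P_{\epsilon=0}=P$ that are quadratic mean differentiable with score $s$ at $\epsilon=0$, i.e. $\int(\sqrt{dP_\epsilon}-\sqrt{dP}-\tfrac{\epsilon}{2}s\sqrt{dP})^2=o(\epsilon^2)$ as $\epsilon\to0$. The tangent set is $\check{\mathcal M}_P=\{s\in L^2(P):\mathscr P(P,\mathcal M,s)\neq\emptyset\}$ and the tangent space $\dot{\mathcal M}_P$ is the $L^2(P)$-closure of its linear span. For a subset $\mathcal U$ of a Hilbert space $\mathcal T$, $u\in\mathcal U$, $t\in\mathcal T$, $\mathscr P(u,\mathcal U,t)$ is the set of paths $\{u_\epsilon:\epsilon\in[0,1]\}\subseteq\mathcal U$ with $\|u_\epsilon-u-\epsilon t\|_{\mathcal T}=o(\epsilon)$ as $\epsilon\to0$; the tangent set is $\check{\mathcal U}_u=\{t\in\mathcal T:\mathscr P(u,\mathcal U,t)\ne\emptyset\}$ and the tangent space $\dot{\mathcal U}_u$ is the $\mathcal T$-closure of its linear span (likewise $\dot{\mathcal R}_r$ for $\mathcal R\subseteq\mathcal Q$, $r\in\mathcal R$). A map $\theta:\mathcal M\times\mathcal U\to\mathcal V$, with $\mathcal U\subseteq\mathcal T$ and $\mathcal V\subseteq\mathcal W$ for ambient Hilbert spaces $\mathcal T,\mathcal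 W$, is totally pathwise differentiable at $(P,u)$ if there is a continuous linear $\dot\theta_{P,u}:\dot{\mathcal M}_P\oplus\dot{\mathcal U}_u\to\mathcal W$ such that for all $s\in\check{\mathcal M}_P$, $t\in\check{\mathcal U}_u$, $\{P_\epsilon\}\in\mathscr P(P,\mathcal M,s)$, $\{u_\epsilon\}\in\mathscr P(u,\mathcal U,t)$, $\|\theta(P_\epsilon,u_\epsilon)-\theta(P,u)-\epsilon\,\dot\theta_{P,u}(s,t)\|_{\mathcal W}=o(\epsilon)$. The (unique) differential operator $\dot\theta_{P,u}$ has Hermitian adjoint $\dot\theta_{P,u}^*:\mathcal W\to\dot{\mathcal M}_P\oplus\dot{\mathcal U}_u$. *)

(* Defs.v *)
From HB Require Import structures.
From mathcomp Require Import all_boot all_order all_algebra.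
From mathcomp Require Import generic_quotient ring_quotient.
From mathcomp Require Import all_classical all_reals all_analysis.
From mathcomp Require Import measurable_realfun.

Set Implicit Arguments.
Unset Strict Implicit.
Unset Printing Implicit Defensive.

Import Order.TTheory GRing.Theory Num.Theory.
Import numFieldNormedType.Exports.

Local Open Scope classical_set_scope.
Local Open Scope ring_scope.
Local Open Scope quotient_scope.
Local Open Scope charge_scope.

(* Real inner product spaces are normed modules whose norm comes from the
   inner product; Hilbert spaces are the complete ones. *)
HB.mixin Record NormedModule_isInnerProduct (R : realType) V
    & NormedModule R V := {
  dot : V -> V -> R ;
  dotC : forall x y, dot x y = dot y x ;
  dot_linearl : forall (a : R) x y z,
    dot (a *: x + y) z = a * dot x z + dot y z ;
  dotxx : forall x, dot x x = `|x| ^+ 2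
}.

#[short(type="innerProductType")]
HB.structure Definition InnerProduct (R : realType) :=
  {V of NormedModule R V & NormedModule_isInnerProduct R V}.

#[short(type="hilbertType")]
HB.structure Definition Hilbert (R : realType) :=
  {V of InnerProduct R V & Complete V}.

(* L^2(mu) as the quotient of the square-integrable functions by a.e. equality,
   with inner product \int f g dmu. The library's LspaceType has no linear
   structure. *)
Section L2.
Context d (Z : measurableType d) (R : realType).
Variable mu : {measure set Z -> \bar R}.

Let Lf := LfunType mu (lee1n 2).

Definition ae_zero : {pred Lf} := fun f => `[< f = cst 0 %[ae mu] >].

Lemma ae_zeroP (f : Lf) :
  reflect (\forall z \ae mu, f z = 0) (f \in ae_zero).
Proof.
apply: (iffP idP) => [/asboolP|] h; last apply/asboolP.
  by apply: filterS h => z /(_ I).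
by apply: filterS h => z fz0 _.
Qed.

Lemma ae_zero_zmod_closed : zmod_closed ae_zero.
Proof.
split; first by apply/ae_zeroP; exact: aeW.
move=> f g /ae_zeroP f0 /ae_zeroP g0; apply/ae_zeroP.
apply: filterS2 f0 g0 => z /= fz gz.
by rewrite -[LHS]/(f z - g z) fz gz subr0.
Qed.

HB.instance Definition _ := GRing.isZmodClosed.Build Lf ae_zero
  ae_zero_zmod_closed.

Definition L2 : Type := {ideal_quot ae_zero}.

HB.instance Definition _ := Choice.on L2.
HB.instance Definition _ := GRing.Zmodule.on L2.
HB.instance Definition _ := EqQuotient.on L2.

Lemma L2_reprP (f : Lf) : \forall z \ae mu, repr (\pi_L2 f) z = f z.
Proof.
have : repr (\pi_L2 f) - f \in ae_zero.
  by rewrite Quotient.idealrBE reprK.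
move=> /ae_zeroP; apply: filterS => z.
by rewrite -[X in X = 0]/(repr (\pi_L2 f) z - f z) => /subr0_eq.
Qed.

Lemma L2_eqP (x y : L2) : x = y <-> \forall z \ae mu, repr x z = repr y z.
Proof.
split=> [->|xy]; first exact: aeW.
rewrite -[x]reprK -[y]reprK; apply/eqP.
rewrite -Quotient.idealrBE; apply/ae_zeroP.
apply: filterS xy => z /= xyz.
by rewrite -[LHS]/(repr x z - repr y z) xyz subrr.
Qed.

Lemma L2_reprD (x y : L2) :
  \forall z \ae mu, repr (x + y) z = repr x z + repr y z.
Proof.
have -> : x + y = \pi_L2 (repr x + repr y) by rewrite raddfD/= !reprK.
exact: L2_reprP.
Qed.

Let scale (a : R) (x : L2) : L2 := \pi_L2 (a *: repr x).

Let scaleE (a : R) (x : L2) :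
  \forall z \ae mu, repr (scale a x) z = a * repr x z.
Proof. exact: L2_reprP. Qed.

Let scaleA a b v : scale a (scale b v) = scale (a * b) v.
Proof.
apply/L2_eqP; apply: filterS3 (scaleE a (scale b v)) (scaleE b v)
  (scaleE (a * b) v) => z -> -> ->.
by rewrite mulrA.
Qed.

Let scale1 : left_id 1 scale.
Proof.
by move=> v; apply/L2_eqP; apply: filterS (scaleE 1 v) => z ->; rewrite mul1r.
Qed.

Let scaleDr : right_distributive scale +%R.
Proof.
move=> a u v; apply/L2_eqP.
apply: filterS3 (scaleE a (u + v)) (L2_reprD u v)
  (filterI (L2_reprD (scale a u) (scale a v))
    (filterI (scaleE a u) (scaleE a v))) => z -> -> [-> [-> ->]].
by rewrite mulrDr.
Qed.

Let scaleDl v : {morph scale^~ v : a b / a + b}.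
Proof.
move=> a b; apply/L2_eqP.
apply: filterS3 (scaleE (a + b) v) (L2_reprD (scale a v) (scale b v))
  (filterI (scaleE a v) (scaleE b v)) => z -> -> [-> ->].
by rewrite mulrDl.
Qed.

HB.instance Definition _ := GRing.Zmodule_isLmodule.Build R L2
  scaleA scale1 scaleDr scaleDl.

Lemma L2_reprZ (a : R) (x : L2) :
  \forall z \ae mu, repr (a *: x) z = a * repr x z.
Proof. exact: scaleE. Qed.


Let norm (x : L2) : R := fine ('N[mu]_2[EFin \o repr x])%E.

Lemma ae_eq_Lnorm2 (f g : Lf) : (\forall z \ae mu, f z = g z) ->
  ('N[mu]_2[EFin \o f] = 'N[mu]_2[EFin \o g])%E.
Proof.
move=> fg; rewrite unlock; congr (_ `^ _)%E.
apply: ge0_ae_eq_integral => //.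
- apply/measurable_EFinP.
  apply/(@measurableT_comp _ _ _ _ _ _ (fun x : R => x `^ 2)%R) => //.
  exact/measurableT_comp.
- apply/measurable_EFinP.
  apply/(@measurableT_comp _ _ _ _ _ _ (fun x : R => x `^ 2)%R) => //.
  exact/measurableT_comp.
- by move=> z _; exact: poweR_ge0.
- by move=> z _; exact: poweR_ge0.
- by apply: filterS fg => z fgz _ /=; rewrite fgz.
Qed.

Let normD x y : norm (x + y) <= norm x + norm y.
Proof.
apply: le_trans (ler_LnormD (repr x) (repr y)).
by rewrite /norm (ae_eq_Lnorm2 (g := repr x + repr y)) ?lexx//; exact: L2_reprD.
Qed.

Let normZ (a : R) x : norm (a *: x) = `|a| * norm x.
Proof.
rewrite /norm (ae_eq_Lnorm2 (g := a *: repr x)); last exact: L2_reprZ.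
rewrite [X in fine X](LnormZ (repr x) a) fineM//.
by rewrite -finite_norm_fine.
Qed.

Let norm_eq0 x : norm x = 0 -> x = 0.
Proof.
move=> /fine_Lnormr_eq0 x0.
have -> : 0 = \pi_L2 0 :> L2 by rewrite raddf0.
rewrite -[x]reprK.
apply/eqP; rewrite -Quotient.idealrBE subr0; apply/ae_zeroP.
by apply: filterS x0 => z /(_ I).
Qed.

HB.instance Definition _ := Lmodule_isNormed.Build R L2 normD normZ norm_eq0.

Let l2dot (x y : L2) : R := \int[mu]_z (repr x z * repr y z).

Lemma L2_mul_integrable (f g : Lf) :
  mu.-integrable setT (fun z => (f z * g z)%:E).
Proof.
apply/Lfun1_integrable; apply: Lfun2_mul_Lfun1; exact: LfunP.
Qed.

Let l2dotC x y : l2dot x y = l2dot y x.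
Proof. by apply: eq_Rintegral => z _; rewrite mulrC. Qed.

Let l2dot_linearl a x y z :
  l2dot (a *: x + y) z = a * l2dot x z + l2dot y z.
Proof.
rewrite /l2dot -RintegralZl//; last exact: L2_mul_integrable.
rewrite -RintegralD//; last 2 first.
- have := L2_mul_integrable (a *: repr x) (repr z).
  by apply: eq_integrable => // t _; congr EFin; exact/esym/mulrA.
- exact: L2_mul_integrable.
congr fine; apply: ae_eq_integral => //.
- by have /integrableP[] := L2_mul_integrable (repr (a *: x + y)) (repr z).
- have /integrableP[+ _] := L2_mul_integrable (a *: repr x + repr y) (repr z).
  apply: eq_measurable_fun => t _.
  rewrite -[LHS]/((a * repr x t + repr y t) * repr z t)%:E.
  by rewrite mulrDl mulrA.
- apply: filterS2 (L2_reprD (a *: x) y) (L2_reprZ a x) => t -> -> _.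
  by rewrite mulrDl mulrA.
Qed.

Let l2dotxx x : l2dot x x = `|x| ^+ 2.
Proof.
have n0 : 0 <= norm x by apply: fine_ge0; exact: Lnorm_ge0.
rewrite -[`|x|]/(norm x) -powR_mulrn//; apply/esym/EFin_inj.
rewrite -poweR_EFin finite_norm_fine powR_Lnorm//.
rewrite /l2dot /Rintegral fineK; last first.
  exact: integrable_fin_num (L2_mul_integrable _ _).
by apply: eq_integral => z _; rewrite /= powR_mulrn// real_normK ?num_real.
Qed.

HB.instance Definition _ := NormedModule_isInnerProduct.Build R L2
  l2dotC l2dot_linearl l2dotxx.

End L2.

Section tangent.
Context (R : realType) (V : normedModType R).

Definition lin_span (S : set V) : set V :=
  [set x | exists n (c : 'I_n -> R) (v : 'I_n -> V),
     (forall i, S (v i)) /\ x = \sum_(i < n) c i *: v i].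

(* Paths are total functions on R; only their values on [0, 1] are constrained
   and the limit is one-sided, at 0^+. *)
Definition paths (U : set V) (u t : V) : set (R -> V) :=
  [set u_ | (forall e, 0 <= e <= 1 -> U (u_ e)) /\
     (fun e => u_ e - u - e *: t) =o_ (0^'+) (fun e => e)].

Definition tangent_set (U : set V) (u : V) : set V :=
  [set t | paths U u t !=set0].

Definition tangent_space (U : set V) (u : V) : set V :=
  closure (lin_span (tangent_set U u)).

End tangent.

(* measure_add P Q as a finite measure, so that it can be the reference measure
   of a Radon-Nikodym derivative. *)
Section prob_add.
Context d (Z : measurableType d) (R : realType) (P Q : probability Z R).

Let add : {measure set Z -> \bar R} := measure_add P Q.

Definition prob_add : set Z -> \bar R := add.

HB.instance Definition _ := Measure.on prob_add.

Let prob_add_fin : fin_num_fun prob_add.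
Proof.
by move=> A mA; rewrite [prob_add A]measure_addE fin_numD !fin_num_measure.
Qed.

HB.instance Definition _ := Measure_isFinite.Build _ _ _ prob_add prob_add_fin.

End prob_add.

Section model.
Context d (Z : measurableType d) (R : realType).
Variable M : set (probability Z R).

Definition sqrt_density (nu : {sigma_finite_measure set Z -> \bar R})
    (N : probability Z R) (z : Z) : R :=
  Num.sqrt (fine ('d (charge_of_finite_measure N) '/d nu z)).

(* \int (sqrt dP' - sqrt dP - e / 2 s sqrt dP)^2. Its value does not depend on
   the dominating measure, taken here to be P' + P. The integrand is always
   integrable because s is in L^2(P), so the real-valued integral is the
   genuine one. *)
Definition qmd_remainder (P : probability Z R) (s : L2 P)
    (P' : probability Z R) (e : R) : R :=
  \int[prob_add P' P]_z
    (sqrt_density (prob_add P' P) P' z - sqrt_density (prob_add P' P) P z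
     - e / 2 * repr s z * sqrt_density (prob_add P' P) P z) ^+ 2.

Definition submodels (P : probability Z R) (s : L2 P) :
    set (R -> probability Z R) :=
  [set P_ | [/\ forall e, 0 <= e <= 1 -> M (P_ e),
     P_ 0 = P &
     (fun e => qmd_remainder s (P_ e) e) =o_ (0^'+) (fun e => e ^+ 2)]].

Definition model_tangent_set (P : probability Z R) : set (L2 P) :=
  [set s | submodels s !=set0].

Arguments model_tangent_set : clear implicits.

Definition model_tangent_space (P : probability Z R) : set (L2 P) :=
  closure (lin_span (model_tangent_set P)).

End model.

Arguments model_tangent_set {d Z R} M P.
Arguments model_tangent_space {d Z R} M P.

Section differentiability.
Context d (Z : measurableType d) (R : realType).
Variable M : set (probability Z R).

Definition joint_tangent_space (T : normedModType R) (U : set T)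
    (P : probability Z R) (u : T) : set (L2 P * T) :=
  model_tangent_space M P `*` tangent_space U u.

Arguments joint_tangent_space {T} U P u.

Definition linear_on (V W : lmodType R) (D : set V) (A : V -> W) :=
  forall (a : R) x y, D x -> D y -> A (a *: x + y) = a *: A x + A y.

(* theta is only evaluated on M * U, and A is a continuous linear operator on
   joint_tangent_space; its values elsewhere are irrelevant. The topology of
   the product type L2 P * T is that of the Hilbert direct sum. *)
Definition is_pathwise_differential (T W : normedModType R) (U : set T)
    (theta : probability Z R -> T -> W) (P : probability Z R) (u : T)
    (A : L2 P * T -> W) :=
  [/\ linear_on (joint_tangent_space U P u) A,
      {within joint_tangent_space U P u, continuous A} &
      forall s t, model_tangent_set M P s -> tangent_set U u t ->
      forall P_ u_, submodels M s P_ -> paths U u t u_ ->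
        (fun e => theta (P_ e) (u_ e) - theta P u - e *: A (s, t))
          =o_ (0^'+) (fun e => e)].

Arguments is_pathwise_differential {T W} U theta P u A.

Definition totally_pathwise_differentiable (T W : normedModType R) (U : set T)
    (theta : probability Z R -> T -> W) (P : probability Z R) (u : T) :=
  exists A, is_pathwise_differential U theta P u A.

End differentiability.

Arguments joint_tangent_space {d Z R} M {T} U P u.
Arguments is_pathwise_differential {d Z R} M {T W} U theta P u A.

(* B is the Hermitian adjoint of A, seen as an operator from the subspace D of
   the Hilbert direct sum V1 + V2 to W. The inner product of the direct sum is
   written out: the product type carries the max norm, so it is not an
   innerProductType. *)
Definition is_adjoint (R : realType) (V1 V2 W : innerProductType R)
    (D : set (V1 * V2)) (A : V1 * V2 -> W) (B : W -> V1 * V2) :=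
  forall w, D (B w) /\
    forall x, D x -> dot (A x) w = dot x.1 (B w).1 + dot x.2 (B w).2.

(* Main.v *)
(** Composing a path with [gamma] gives a path in [Rs] whose direction is
    [dgamma (s, t)], so the differential of [eta] applies along it and
    [fun x => deta (x.1, dgamma x)] is a differential of [beta]. It is a
    legitimate operator on the joint tangent space because [dgamma] maps that
    space into the tangent space of [Rs]: this, and the uniqueness of
    differentials, extend from pairs of tangent directions to the closed spans
    by linearity and continuity, and linearity suffices because 0 is a tangent
    direction of both factors (constant paths). The adjoint formula then holds
    by uniqueness of adjoints on a subspace. *)

Require Import Defs.
From HB Require Import structures.
From mathcomp Require Import all_boot all_order all_algebra.
From mathcomp Require Import all_classical all_reals all_analysis.
From mathcomp Require Import measurable_realfun.

Set Implicit Arguments.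
Unset Strict Implicit.
Unset Printing Implicit Defensive.

Import Order.TTheory GRing.Theory Num.Theory.
Import numFieldNormedType.Exports.

Local Open Scope classical_set_scope.
Local Open Scope ring_scope.

(** * Linear subspaces, spans and their closures *)

Section subspaces.
Context (R : realType).

Definition subspace_closed (V : lmodType R) (D : set V) :=
  D 0 /\ forall (a : R) x y, D x -> D y -> D (a *: x + y).

Lemma subspace_closed_sum (V : lmodType R) (D : set V) n (c : 'I_n -> R)
    (v : 'I_n -> V) :
  subspace_closed D -> (forall i, D (v i)) -> D (\sum_(i < n) c i *: v i).
Proof.
move=> [D0 DD] Dv.
elim: n c v Dv => [|n IHn] c v Dv; first by rewrite big_ord0.
by rewrite big_ord_recl; apply: DD => //; exact: IHn.
Qed.

Lemma sub_lin_span (V : normedModType R) (S : set V) : S `<=` lin_span S.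
Proof.
move=> x Sx; exists 1%N, (fun=> 1), (fun=> x); split=> //.
by rewrite big_ord1 scale1r.
Qed.

Lemma lin_span_closed (V : normedModType R) (S : set V) :
  subspace_closed (lin_span S).
Proof.
split.
  by exists 0%N, (fun=> 0), (fun=> 0); split; [case|rewrite big_ord0].
move=> a _ _ [m [c [v [Sv ->]]]] [n [k [w [Sw ->]]]].
(* The two families are concatenated, with the first coefficients scaled by [a]. *)
exists (m + n)%N.
exists (fun i : 'I_(m + n) =>
  match fintype.split i with inl j => a * c j | inr j => k j end).
exists (fun i : 'I_(m + n) =>
  match fintype.split i with inl j => v j | inr j => w j end).
split=> [i|]; first by case: fintype.split.
rewrite big_split_ord/= scaler_sumr; congr (_ + _); apply: eq_bigr => i _.
  by rewrite (unsplitK (inl i)) scalerA.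
by rewrite (unsplitK (inr i)).
Qed.

(** Closure points are limits of proper filters [F] and [G] carried by [D]; the image of their
    product under the continuous map [a *: p.1 + p.2] is again carried by [D]. *)
Lemma closure_subspace (V : normedModType R) (D : set V) :
  subspace_closed D -> subspace_closed (closure D).
Proof.
move=> [D0 DD]; split; first exact: subset_closure.
move=> a x y; rewrite closureEcvg => -[F FF [Fx DF]] -[G GG [Gy DG]].
exists ((fun p : V * V => a *: p.1 + p.2) @ filter_prod F G).
  exact: fmap_proper_filter.
split.
  apply: (@cvgD _ _ _ (filter_prod F G) _ (fun p => a *: p.1) snd).
    apply: cvgZr; apply: cvg_comp Fx; exact: cvg_fst.
  by apply: cvg_comp Gy; exact: cvg_snd.
move=> A DA; exists (D, D) => /=.
  by split; [apply: DF|apply: DG].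
by move=> [p q] [/= Dp Dq]; apply: DA; exact: DD.
Qed.

Lemma tangent_space_closed (V : normedModType R) (U : set V) u :
  subspace_closed (tangent_space U u).
Proof. exact/closure_subspace/lin_span_closed. Qed.

Lemma linear_on0 (V W : lmodType R) (D : set V) (A : V -> W) :
  subspace_closed D -> linear_on D A -> A 0 = 0.
Proof.
move=> [D0 _] lA; have := lA (-1) 0 0 D0 D0.
by rewrite scaler0 add0r scaleN1r addNr.
Qed.

Lemma linear_on_sum (V W : lmodType R) (D : set V) (A : V -> W) n
    (c : 'I_n -> R) (v : 'I_n -> V) :
  subspace_closed D -> linear_on D A -> (forall i, D (v i)) ->
  A (\sum_(i < n) c i *: v i) = \sum_(i < n) c i *: A (v i).
Proof.
move=> sD lA; elim: n c v => [|n IHn] c v Dv.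
  by rewrite !big_ord0; exact: linear_on0 sD lA.
rewrite !big_ord_recl lA//; last exact: subspace_closed_sum.
by rewrite IHn.
Qed.

(** A neighbourhood of [A x] pulls back only to a neighbourhood relative to [D]; it still contains a
    point of [S] because [S] lies in [D]. *)
Lemma continuous_within_closure (V W : topologicalType) (S D : set V)
    (C : set W) (A : V -> W) :
  S `<=` D -> {within D, continuous A} -> (forall x, S x -> C (A x)) ->
  forall x, D x -> closure S x -> closure C (A x).
Proof.
move=> SD /subspace_continuousP cA AC x Dx Sx B /(cA x Dx) nB.
have [y [Sy +]] := Sx _ nB.
by move=> /(_ (SD _ Sy)) By; exists (A y); split=> //; exact: AC.
Qed.

Lemma closure_setX (V W : topologicalType) (A : set V) (B : set W) p :
  closure A p.1 -> closure B p.2 -> closure (A `*` B) p.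
Proof.
move=> Ap Bp C [[X Y] /= [nX nY] XY].
have [x [Ax Xx]] := Ap _ nX; have [y [By Yy]] := Bp _ nY.
by exists (x, y); split=> //; exact: XY.
Qed.

End subspaces.

(** * Continuous linear operators on a product of two closed spans *)

Section product_domain.
Context (R : realType) (V1 V2 : normedModType R) (S1 : set V1) (S2 : set V2).

Let D : set (V1 * V2) := closure (lin_span S1) `*` closure (lin_span S2).

Lemma closure_span_setX_closed : subspace_closed D.
Proof.
have [z1 l1] := closure_subspace (lin_span_closed S1).
have [z2 l2] := closure_subspace (lin_span_closed S2).
split=> [//|a [x1 x2] [y1 y2] [/= ? ?] [/= ? ?]].
by split; [exact: l1|exact: l2].
Qed.

(* Since both factors contain 0, the product of the spans is spanned by the
   vectors (s, 0) and (0, t), which lie in [S1 `*` S2]. *)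
Lemma linear_on_span_image (W : normedModType R) (A : V1 * V2 -> W)
    (C : set W) :
  S1 0 -> S2 0 -> linear_on D A -> {within D, continuous A} ->
  subspace_closed C ->
  (forall s t, S1 s -> S2 t -> C (A (s, t))) ->
  forall x, D x -> closure C (A x).
Proof.
move=> S10 S20 lA cA sC SC x Dx.
have sub1 : S1 `<=` closure (lin_span S1).
  by move=> s ?; apply/subset_closure/sub_lin_span.
have sub2 : S2 `<=` closure (lin_span S2).
  by move=> s ?; apply/subset_closure/sub_lin_span.
have sD := closure_span_setX_closed.
(* Continuity within [D] reduces the claim to the product of the spans, whose closure contains
   [D]. *)
apply: (continuous_within_closure (S := lin_span S1 `*` lin_span S2) _ cA) => //.
- by move=> y [? ?]; split; exact: subset_closure.
- move=> [p q] [/= [m [c [v [Sv ->]]]] [n [k [w [Sw ->]]]]].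
  have -> : (\sum_(i < m) c i *: v i, \sum_(i < n) k i *: w i) =
      1 *: (\sum_(i < m) c i *: (v i, 0)) + \sum_(i < n) k i *: (0, w i)
      :> V1 * V2.
    rewrite scale1r; apply: injective_projections => /=.
      rewrite !(raddf_sum fst)/= [X in _ + X]big1 ?addr0// => i _.
      exact: scaler0.
    rewrite !(raddf_sum snd)/= [X in X + _]big1 ?add0r// => i _.
    exact: scaler0.
  have D1 i : D (v i, 0) by split; [exact/sub1/Sv|exact: sub2].
  have D2 i : D (0, w i) by split; [exact: sub1|exact/sub2/Sw].
  rewrite lA; [|exact: subspace_closed_sum..].
  rewrite !(linear_on_sum _ sD lA)//.
  by apply: sC.2; apply: subspace_closed_sum => // i; exact: SC.
- by case: Dx => ? ?; exact: closure_setX.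
Qed.

(** The preceding lemma applies to [A \- B] with the subspace [[set 0]], which is its own closure
    because normed spaces are Hausdorff. *)
Lemma linear_on_span_unique (W : normedModType R) (A B : V1 * V2 -> W) :
  S1 0 -> S2 0 ->
  linear_on D A -> {within D, continuous A} ->
  linear_on D B -> {within D, continuous B} ->
  (forall s t, S1 s -> S2 t -> A (s, t) = B (s, t)) ->
  forall x, D x -> A x = B x.
Proof.
move=> S10 S20 lA cA lB cB AB x Dx.
have c0 : closed [set (0 : W)].
  apply: accessible_closed_set1; apply: hausdorff_accessible.
  exact: norm_hausdorff.
apply/eqP; rewrite -subr_eq0; apply/eqP.
suff : closure [set (0 : W)] (A x - B x) by rewrite -((closure_id _).1 c0).
apply: (linear_on_span_image (A := A \- B)) Dx => //.
- move=> a y z Dy Dz /=; rewrite lA// lB// scalerBr opprD !addrA; congr (_ + _).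
  by rewrite addrAC.
- by move=> y; apply: cvgB; [exact: cA|exact: cB].
- split=> // a _ _ -> ->; by rewrite scaler0 addr0.
- by move=> s t S1s S2t /=; rewrite AB// subrr.
Qed.

End product_domain.

(** * Zero as a tangent direction, for sets and for models *)

Section zero_tangent.
Context (R : realType).

Lemma eqo0 (V W : normedModType R) (F : filter_on R) (g : R -> W) :
  (fun=> 0 : V) =o_ F g.
Proof.
apply/eqoP => eps eps0; near=> e.
by rewrite normr0 mulr_ge0// ltW.
Unshelve. all: by end_near. Qed.

(** For each [eps], a single small [e > 0] suffices: dividing the little-o bound by [e] leaves
    [|c| <= eps]. *)
Lemma scale_littleo_eq0 (V : normedModType R) (c : V) :
  (fun e : R => e *: c) =o_ (0^'+) (fun e => e) -> c = 0.
Proof.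
move=> /eqoP co; apply/eqP; rewrite -normr_le0; apply/ler_addgt0Pr => eps eps0.
have [e [e0 /=]] : exists e : R, 0 < e /\ `|e *: c| <= eps * `|e|.
  near (0 : R)^'+ => e; exists e; split; first by [].
  by near: e; exact: co.
by rewrite normrZ mulrC ler_pM2r ?normr_gt0 ?gt_eqF// add0r.
Unshelve. all: by end_near. Qed.

Lemma tangent_set0 (V : normedModType R) (U : set V) u :
  U u -> tangent_set U u 0.
Proof.
move=> Uu; exists (fun=> u); split=> [//|].
under eq_fun do rewrite scaler0 subrr subr0.
exact: eqo0.
Qed.

Context d (Z : measurableType d).

Lemma measurable_Radon_Nikodym (nu : {charge set Z -> \bar R})
    (mu : {sigma_finite_measure set Z -> \bar R}) :
  measurable_fun setT (Radon_Nikodym nu mu).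
Proof.
have [numu|numu] := pselect (nu `<< mu).
  by have /integrableP[] := Radon_Nikodym_integrable numu.
(* Without absolute continuity the derivative is a constant default value. *)
by rewrite /Radon_Nikodym; case: pselect.
Qed.

Lemma measurable_sqrt_density (nu : {sigma_finite_measure set Z -> \bar R})
    (N : probability Z R) : measurable_fun setT (sqrt_density nu N).
Proof.
apply: (measurableT_comp (f := @Num.sqrt R)).
  apply: continuous_measurable_fun; exact: sqrt_continuous.
apply: (measurableT_comp (f := @fine R)) => //.
exact: measurable_Radon_Nikodym.
Qed.

(** The score 0 is a class whose representative vanishes only [P]-almost everywhere, so the
    integrand is null almost everywhere rather than identically. *)
Lemma qmd_remainder0 (P : probability Z R) e :
  qmd_remainder (0 : L2 P) P e = 0.
Proof.
rewrite /qmd_remainder /Rintegral.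
set mu := prob_add P P; set q := sqrt_density mu P.
have -> : (\int[mu]_z ((q z - q z - e / 2 * repr (0 : L2 P) z * q z) ^+ 2)%:E
    = \int[mu]_z (cst 0 z))%E.
  apply: ae_eq_integral => //.
    apply/measurable_EFinP/measurable_funX.
    have mq := measurable_sqrt_density mu P.
    apply: measurable_funB; first exact: measurable_funB.
    apply: measurable_funM => //; apply: measurable_funM => //.
  have [N [mN PN0 N0]] : \forall z \ae P, repr (0 : L2 P) z = 0.
    have -> : (0 : L2 P) = \pi_(L2 P)%qT 0 by rewrite raddf0.
    exact: (L2_reprP (0 : LfunType P (lee1n 2))).
  (* A null set of [P] is also null for the dominating measure [P + P]. *)
  exists N; split=> //.
    transitivity (P N + P N)%E; first exact: measure_addE.
    by rewrite [P N]PN0 adde0.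
  move=> z /= nz; apply: N0 => /= z0; apply: nz => _.
  by rewrite z0 mulr0 mul0r subrr subr0 expr0n.
by rewrite integral0.
Qed.

Lemma model_tangent_set0 (M : set (probability Z R)) P :
  M P -> model_tangent_set M P 0.
Proof.
move=> MP; exists (fun=> P); split=> //.
under eq_fun do rewrite qmd_remainder0.
exact: eqo0.
Qed.

End zero_tangent.

(** * Inner product identities and uniqueness of adjoints *)

Section inner_product.
Context (R : realType).

Lemma dot0l (V : innerProductType R) (y : V) : dot 0 y = 0.
Proof.
have := dot_linearl 1 0 0 y.
by rewrite scaler0 addr0 mul1r => /eqP; rewrite addrC -subr_eq subrr => /eqP.
Qed.

Lemma dotDl (V : innerProductType R) (x y z : V) :
  dot (x + y) z = dot x z + dot y z.
Proof. by have := dot_linearl 1 x y z; rewrite scale1r mul1r. Qed.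

Lemma dotDr (V : innerProductType R) (x y z : V) :
  dot z (x + y) = dot z x + dot z y.
Proof. by rewrite dotC dotDl !(dotC _ z). Qed.

Lemma dotBr (V : innerProductType R) (x y z : V) :
  dot z (x - y) = dot z x - dot z y.
Proof.
by apply/eqP; rewrite -subr_eq opprK -dotDr subrK.
Qed.

(** Both adjoint identities are tested on [B w - B' w], itself in [D]; subtracting them makes the
    squared norms of its two components sum to 0. *)
Lemma is_adjoint_unique (V1 V2 W : innerProductType R) (D : set (V1 * V2))
    (A : V1 * V2 -> W) (B B' : W -> V1 * V2) :
  subspace_closed D -> is_adjoint D A B -> is_adjoint D A B' -> B =1 B'.
Proof.
move=> [_ DD] adjB adjB' w.
have [DB aB] := adjB w; have [DB' aB'] := adjB' w.
have DBB' : D (B w - B' w) by rewrite addrC -scaleN1r; exact: DD.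
have /eqP := aB _ DBB'; rewrite (aB' _ DBB') eq_sym -subr_eq0.
rewrite opprD addrACA -!dotBr !dotxx.
rewrite paddr_eq0 ?sqr_ge0// !sqrf_eq0 !normr_eq0 !subr_eq0.
by move=> /andP[/eqP e1 /eqP e2]; exact: injective_projections.
Qed.

End inner_product.

(** * Uniqueness, range and composition of pathwise differentials *)

Section pathwise_differential.
Context (R : realType) (d : measure_display) (Z : measurableType d).
Context (M : set (probability Z R)).

Lemma joint_tangent_space_closed (T : normedModType R) (U : set T)
    (P : probability Z R) u :
  subspace_closed (joint_tangent_space M U P u).
Proof. exact: closure_span_setX_closed. Qed.

(** Along a common path the two first-order remainders differ by [e *: (B (s, t) - A (s, t))], which
    is therefore [o(e)]. *)
Lemma pathwise_differential_unique (T W : normedModType R) (U : set T)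
    (theta : probability Z R -> T -> W) (P : probability Z R) u (A B : L2 P * T -> W) :
  M P -> U u ->
  is_pathwise_differential M U theta P u A ->
  is_pathwise_differential M U theta P u B ->
  forall x, joint_tangent_space M U P u x -> A x = B x.
Proof.
move=> MP Uu [lA cA dA] [lB cB dB].
apply: linear_on_span_unique => //.
- exact: model_tangent_set0.
- exact: tangent_set0.
move=> s t Ms Ut; have [P_ sP] := Ms; have [u_ tu] := Ut.
apply/esym/eqP; rewrite -subr_eq0; apply/eqP/scale_littleo_eq0.
have eA := dA _ _ Ms Ut _ _ sP tu.
have eB := dB _ _ Ms Ut _ _ sP tu.
have -> : (fun e => e *: (B (s, t) - A (s, t))) =
    (fun e => theta (P_ e) (u_ e) - theta P u - e *: A (s, t)) +
    - (fun e => theta (P_ e) (u_ e) - theta P u - e *: B (s, t)).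
  apply/funext => e; rewrite !fctE.
  by rewrite opprB addrC addrA subrK scalerBr.
exact: eqoE (add2o eA (oppfo (cst 0) eB)).
Qed.

Context (Q T W : normedModType R) (Rs : set Q) (U : set T).
Context (gamma : probability Z R -> T -> Q) (eta : probability Z R -> Q -> W).
Context (P : probability Z R) (u : T).
Context (dgamma : L2 P * T -> Q) (deta : L2 P * Q -> W).
Hypotheses (MP : M P) (Uu : U u).
Hypothesis gammaRs : forall P' u', M P' -> U u' -> Rs (gamma P' u').
Hypothesis gamma_diff : is_pathwise_differential M U gamma P u dgamma.
Hypothesis eta_diff : is_pathwise_differential M Rs eta P (gamma P u) deta.

(** The expansion of [gamma] along the path is literally the first-order condition in [paths]. *)
Lemma pathwise_path s t P_ u_ : model_tangent_set M P s ->
  tangent_set U u t -> submodels M s P_ -> paths U u t u_ ->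
  paths Rs (gamma P u) (dgamma (s, t)) (fun e => gamma (P_ e) (u_ e)).
Proof.
move=> Ms Ut sP tu; have [_ _ dg] := gamma_diff; split; last exact: dg.
by move=> e e01; apply: gammaRs; [case: sP => + _ _|case: tu => + _]; exact.
Qed.

Lemma pathwise_differential_tangent x : joint_tangent_space M U P u x ->
  tangent_space Rs (gamma P u) (dgamma x).
Proof.
have [lg cg _] := gamma_diff.
(* The target subspace is the span of the tangent set of [Rs], whose closure is its tangent
   space. *)
apply: linear_on_span_image => //.
- exact: model_tangent_set0.
- exact: tangent_set0.
- exact: lin_span_closed.
move=> s t Ms Ut; have [P_ sP] := Ms; have [u_ tu] := Ut.
by apply: sub_lin_span; eexists; exact: pathwise_path sP tu.
Qed.

Lemma pathwise_differential_chain :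
  is_pathwise_differential M U (fun P' u' => eta P' (gamma P' u')) P u
    (fun x => deta (x.1, dgamma x)).
Proof.
have [lg /subspace_continuousP cg dg] := gamma_diff.
have [le /subspace_continuousP ce de] := eta_diff.
(* Linearity and continuity of [deta] are available only on its own joint tangent space. *)
have img x : joint_tangent_space M U P u x ->
    joint_tangent_space M Rs P (gamma P u) (x.1, dgamma x).
  move=> Dx; split; first by case: Dx.
  exact: pathwise_differential_tangent.
split.
- by move=> a x y Dx Dy; rewrite lg// -le; [|exact: img..].
- apply/subspace_continuousP => x Dx.
  have cpair : (y.1, dgamma y) @[y --> within (joint_tangent_space M U P u)
      (nbhs x)] --> (x.1, dgamma x).
    have c1 : y.1 @[y --> within (joint_tangent_space M U P u) (nbhs x)] -->
        x.1 by apply: cvg_within_filter; case: x {Dx} => ? ?; exact: cvg_fst.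
    exact: cvg_pair c1 (cg _ Dx).
  (* The preimage under [deta] is controlled only inside its domain; [img] puts the nearby pairs
     there. *)
  move=> B /(ce _ (img _ Dx))/cpair; apply: filterS2 (withinT _ _) => y Dy.
  by apply; exact: img.
- move=> s t Ms Ut P_ u_ sP tu; apply: de => //.
    by eexists; exact: pathwise_path sP tu.
  exact: pathwise_path.
Qed.

End pathwise_differential.

(** * The chain rule and the adjoint formula *)

Theorem lemmaS3 (R : realType) (d : measure_display) (Z : measurableType d)
    (M : set (probability Z R)) (Q T W : hilbertType R)
    (Rs : set Q) (U : set T) (P : probability Z R) (u : T)
    (gamma : probability Z R -> T -> Q) (eta : probability Z R -> Q -> W)
    (dgamma : L2 P * T -> Q) (deta : L2 P * Q -> W)
    (MP : M P) (Uu : U u)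
    (gammaRs : forall P' u', M P' -> U u' -> Rs (gamma P' u'))
    (gamma_diff : is_pathwise_differential M U gamma P u dgamma)
    (eta_diff : is_pathwise_differential M Rs eta P (gamma P u) deta) :
  let beta := fun P' u' => eta P' (gamma P' u') in
  totally_pathwise_differentiable M U beta P u /\
  forall dbeta : L2 P * T -> W, is_pathwise_differential M U beta P u dbeta ->
    (forall s t, model_tangent_space M P s -> tangent_space U u t ->
       tangent_space Rs (gamma P u) (dgamma (s, t)) /\
       dbeta (s, t) = deta (s, dgamma (s, t))) /\
    (forall (gammaS : Q -> L2 P * T) (etaS : W -> L2 P * Q),
       is_adjoint (joint_tangent_space M U P u) dgamma gammaS ->
       is_adjoint (joint_tangent_space M Rs P (gamma P u)) deta etaS ->
       forall betaS : W -> L2 P * T,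
         is_adjoint (joint_tangent_space M U P u) dbeta betaS <->
         (forall w, betaS w = ((etaS w).1, 0) + gammaS (etaS w).2)).
Proof.
move=> beta.
have chain := pathwise_differential_chain MP Uu gammaRs gamma_diff eta_diff.
split; first by eexists; exact: chain.
move=> dbeta beta_diff.
(* An arbitrary differential [dbeta] is tied to the composite only on the joint tangent space. *)
have dbetaE := pathwise_differential_unique MP Uu beta_diff chain.
have tan := pathwise_differential_tangent MP Uu gammaRs gamma_diff.
have sD := joint_tangent_space_closed M U P u.
split=> [s t Ms Ut|gammaS etaS adj_gamma adj_eta betaS].
  by split; [exact: tan|exact: dbetaE].
pose formula w : L2 P * T := ((etaS w).1, 0) + gammaS (etaS w).2.
have adj_formula :
    is_adjoint (joint_tangent_space M U P u) dbeta formula.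
  move=> w; have [[D1 D2] aE] := adj_eta w; have [DG aG] := adj_gamma (etaS w).2.
  split=> [|x Dx].
    rewrite /formula -[X in X + _]scale1r; apply: sD.2 => //.
    by split=> //; have [] := tangent_space_closed U u.
  (* The adjoint of [deta] is used at [(x.1, dgamma x)], then that of [dgamma] at [(etaS w).2]; the
     component 0 of the formula contributes nothing. *)
  rewrite dbetaE// aE/=; last by split; [case: Dx|exact: tan].
  by rewrite aG// !dotDr [dot _ 0]dotC dot0l add0r addrA.
split=> [adj_beta w|betaSE w].
  exact: is_adjoint_unique sD adj_beta adj_formula w.
by rewrite betaSE; exact: adj_formula.
Qed.
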